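(* Any symmetric bilinear form $\lambda$ has a universal symmetric quadratic refinement. In fact, the forgetful functor $R(\lambda,\mu)=\lambda$ from the category $\mathsf{SQF}$ of symmetric quadratic forms to the category $\mathsf{SF}$ of symmetric forms has a left adjoint $L:\mathsf{SF}\to\mathsf{SQF}$, $L(\lambda)=(\lambda,\mu^c_\lambda)$.
   Context: A symmetric quadratic group $\mathfrak M=(M_e\overset{h}{\to}M_{ee}\overset{p}{\to}M_e)$ consists of two abelian groups $M_e,M_{ee}$ and two homomorphisms $h,p$ with $hp=2\,\mathrm{id}$ on $M_{ee}$ and $ph=2\,\mathrm{id}$ on $M_e$. A morphism $\beta:\mathfrak M\to\mathfrak M'$ is a pair of homomorphisms $\beta_e:M_e\to M'_e$, $\beta_{ee}:M_{ee}\to M'_{ee}$ with $h'\beta_e=\beta_{ee}h$ and $p'\beta_{ee}=\beta_e p$. A symmetric quadratic form $(\lambda,\mu):A\to\mathfrak M$ on an abelian group $A$ with values in a symmetric quadratic group $\mathfrak M$ is a bilinear map $\lambda:A\times A\to M_{ee}$ and a map $\mu:A\to M_e$ with $\mu(a+a')=\mu(a)+\mu(a')+p(\lambda(a,a'))$ and $h(\mu(a))=\lambda(a,a)$ for all $a,a'\in A$; then automatically $\lambda(a,a')=\lambda(a',a)$. The category $\mathsf{SQF}$ has these as objects ($A$ and $\mathfrak M$ being part of the data); a morphism $(\lambda,\mu)\to(\lambda',\mu')$ is a homomorphism $\alpha:A\to A'$ and a morphism $\beta:\mathfrak M\to\mathfrak M'$ with $\lambda'(\alpha(a_1),\alpha(a_2))=\beta_{ee}(\lambda(a_1,a_2))$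 and $\mu'\circ\alpha=\beta_e\circ\mu$. A symmetric form is a bilinear map $\lambda:A\times A\to M$ of abelian groups with $\lambda(a,a')=\lambda(a',a)$. The category $\mathsf{SF}$ has these as objects; a morphism $\lambda\to\lambda'$ is a pair of homomorphisms $\alpha:A\to A'$, $\beta_{ee}:M\to M'$ with $\lambda'(\alpha(a_1),\alpha(a_2))=\beta_{ee}(\lambda(a_1,a_2))$. A symmetric quadratic refinement of a symmetric form $\lambda:A\times A\to M$ is a symmetric quadratic form $(\lambda,\mu):A\to\mathfrak M$ with $M_{ee}=M$. It is universal if it is initial among these, with morphisms being the morphisms of $\mathsf{SQF}$ lying over the identity of $\lambda$ ($\alpha=\mathrm{id}_A$, $\beta_{ee}=\mathrm{id}_M$). Construction of $(\lambda,\mu^c_\lambda)$. Given a symmetric form $\lambda:A\times A\to M$, let $M\times_\lambda A$ be the set $M\times A$ with (commutative) group law $(m,a)+(m',a'):=(m+m'-\lambda(a,a'),\,a+a')$, and let $M^c_e$ be its quotient by the relations $(-2\lambda(a,a),-2a)=0$ for all $a\in A$; write $[m,a]$ for the class of $(m,a)$. Put $M_{ee}:=M$, $p^c_\lambda(m):=[m,0]$, $h^c_\lambda[m,a]:=2m+\lambda(a,a)$ and $\mu^c_\lambda(a):=[0,a]$. *)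

(* Defs.v *)
From HB Require Import structures.
From mathcomp Require Import all_boot all_algebra.
From mathcomp Require Import boolp.

Set Implicit Arguments.
Unset Strict Implicit.
Unset Printing Implicit Defensive.

Import GRing.Theory.
Local Open Scope ring_scope.

Record category := Category {
  obj :> Type;
  hom : obj -> obj -> Type;
  idm : forall x, hom x x;
  comp : forall x y z, hom y z -> hom x y -> hom x z;
  comp1m : forall x y (f : hom x y), comp (idm y) f = f;
  compm1 : forall x y (f : hom x y), comp f (idm x) = f;
  compA : forall x y z t (f : hom z t) (g : hom y z) (k : hom x y),
    comp f (comp g k) = comp (comp f g) k
}.
Arguments hom {_} _ _.
Arguments idm {_} _.
Arguments comp {_ _ _ _} _ _.

Record functor (C D : category) := Functor {
  fobj :> C -> D;
  fmor : forall x y, hom x y -> hom (fobj x) (fobj y);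
  fmor_id : forall x, fmor (idm x) = idm (fobj x);
  fmor_comp : forall x y z (f : hom y z) (g : hom x y),
    fmor (comp f g) = comp (fmor f) (fmor g)
}.
Arguments fmor {_ _} _ {_ _} _.

Record adjunction (C D : category) (L : functor C D) (R : functor D C) :=
  Adjunction {
  transp : forall (x : C) (y : D), hom (L x) y -> hom x (R y);
  transp_bij : forall x y, bijective (@transp x y);
  transp_nat : forall (x x' : C) (y y' : D)
      (f : hom x' x) (g : hom y y') (u : hom (L x) y),
    transp (comp g (comp u (fmor L f)))
    = comp (fmor R g) (comp (transp u) f)
}.

Definition is_left_adjoint (C D : category)
    (L : functor C D) (R : functor D C) : Prop :=
  inhabited (adjunction L R).

Definition add_id (V : zmodType) : {additive V -> V} := idfun.

Definition add_comp (U V W : zmodType)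
    (f : {additive V -> W}) (g : {additive U -> V}) : {additive U -> W} :=
  f \o g.

Lemma additive_ext (U V : zmodType) (f g : {additive U -> V}) :
  f =1 g -> f = g.
Proof.
move=> /funext; case: f => f [[pf]]; case: g => g [[pg]] /= fg.
by case: g / fg pg => pg; rewrite (Prop_irrelevance pf pg).
Qed.

Definition biadditive (A B M : zmodType) (l : A -> B -> M) : Prop :=
  (forall b, {morph l^~ b : x y / x + y}) /\
  (forall a, {morph l a : x y / x + y}).

Section Biadditive.
Variables (A B M : zmodType) (l : A -> B -> M).
Hypothesis lP : biadditive l.

Lemma biaddDl x y b : l (x + y) b = l x b + l y b.
Proof. exact: lP.1. Qed.
Lemma biaddDr a x y : l a (x + y) = l a x + l a y.
Proof. exact: lP.2. Qed.
Lemma biadd0l b : l 0 b = 0.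
Proof. by apply: (addIr (l 0 b)); rewrite -biaddDl !add0r. Qed.
Lemma biadd0r a : l a 0 = 0.
Proof. by apply: (addIr (l a 0)); rewrite -biaddDr !add0r. Qed.
Lemma biaddNl a b : l (- a) b = - l a b.
Proof. by apply: (addIr (l a b)); rewrite -biaddDl !addNr biadd0l. Qed.
Lemma biaddNr a b : l a (- b) = - l a b.
Proof. by apply: (addIr (l a b)); rewrite -biaddDr !addNr biadd0r. Qed.
End Biadditive.

Record sym_form := SymForm {
  sf_dom : zmodType;
  sf_val : zmodType;
  sf_form :> sf_dom -> sf_dom -> sf_val;
  sf_biadd : biadditive sf_form;
  sf_sym : forall a a', sf_form a a' = sf_form a' a
}.

Record sf_hom (l l' : sym_form) := SFHom {
  sf_alpha : {additive sf_dom l -> sf_dom l'};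
  sf_beta : {additive sf_val l -> sf_val l'};
  sf_homP : forall a1 a2, l' (sf_alpha a1) (sf_alpha a2) = sf_beta (l a1 a2)
}.

Lemma sf_hom_ext l l' (f g : sf_hom l l') :
  sf_alpha f =1 sf_alpha g -> sf_beta f =1 sf_beta g -> f = g.
Proof.
case: f => a b p; case: g => a' b' p' /= /additive_ext aE /additive_ext bE.
by case: a' / aE p' => p'; case: b' / bE p' => p'; rewrite (Prop_irrelevance p p').
Qed.

Definition sf_id (l : sym_form) : sf_hom l l :=
  @SFHom l l (add_id _) (add_id _) (fun _ _ => erefl).

Lemma sf_comp_subproof (l l' l'' : sym_form)
    (f : sf_hom l' l'') (g : sf_hom l l') a1 a2 :
  l'' (add_comp (sf_alpha f) (sf_alpha g) a1)
      (add_comp (sf_alpha f) (sf_alpha g) a2)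
  = add_comp (sf_beta f) (sf_beta g) (l a1 a2).
Proof. by rewrite /= !sf_homP. Qed.

Definition sf_comp l l' l'' (f : sf_hom l' l'') (g : sf_hom l l') :
    sf_hom l l'' :=
  SFHom (sf_comp_subproof f g).

Definition SF : category.
Proof.
refine (@Category sym_form sf_hom sf_id sf_comp _ _ _);
  by move=> *; apply: sf_hom_ext.
Defined.

Record sqgroup := SQGroup {
  sqg_e : zmodType;
  sqg_ee : zmodType;
  sqg_h : {additive sqg_e -> sqg_ee};
  sqg_p : {additive sqg_ee -> sqg_e};
  sqg_hp : forall m, sqg_h (sqg_p m) = m *+ 2;
  sqg_ph : forall x, sqg_p (sqg_h x) = x *+ 2
}.
Arguments sqg_h {_}.
Arguments sqg_p {_}.

Record sqg_hom (M M' : sqgroup) := SQGHom {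
  beta_e : {additive sqg_e M -> sqg_e M'};
  beta_ee : {additive sqg_ee M -> sqg_ee M'};
  sqg_hom_h : forall x, sqg_h (beta_e x) = beta_ee (sqg_h x);
  sqg_hom_p : forall m, sqg_p (beta_ee m) = beta_e (sqg_p m)
}.

(* Symmetry of [sqf_lambda] is not a field: it is derived in [sqf_sym]. *)
Record sqform := SQForm {
  sqf_dom : zmodType;
  sqf_grp : sqgroup;
  sqf_lambda : sqf_dom -> sqf_dom -> sqg_ee sqf_grp;
  sqf_mu : sqf_dom -> sqg_e sqf_grp;
  sqf_biadd : biadditive sqf_lambda;
  sqf_muD : forall a a',
    sqf_mu (a + a') = sqf_mu a + sqf_mu a' + sqg_p (sqf_lambda a a');
  sqf_hmu : forall a, sqg_h (sqf_mu a) = sqf_lambda a a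
}.
Arguments sqf_lambda : clear implicits.
Arguments sqf_mu : clear implicits.

Lemma sqf_sym (q : sqform) a a' : sqf_lambda q a a' = sqf_lambda q a' a.
Proof.
have := sqf_hmu (a + a').
rewrite sqf_muD !raddfD /= !sqf_hmu sqg_hp.
rewrite (biaddDl (sqf_biadd q)) !(biaddDr (sqf_biadd q)) mulr2n !addrA.
by rewrite [X in _ = X -> _]addrAC [X in _ = X + _ -> _]addrAC => /addrI.
Qed.

Record sqf_hom (q q' : sqform) := SQFHom {
  sqf_alpha : {additive sqf_dom q -> sqf_dom q'};
  sqf_beta : sqg_hom (sqf_grp q) (sqf_grp q');
  sqf_hom_lambda : forall a1 a2,
    sqf_lambda q' (sqf_alpha a1) (sqf_alpha a2)
    = beta_ee sqf_beta (sqf_lambda q a1 a2);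
  sqf_hom_mu : forall a, sqf_mu q' (sqf_alpha a) = beta_e sqf_beta (sqf_mu q a)
}.

Definition sqg_id (M : sqgroup) : sqg_hom M M :=
  @SQGHom M M (add_id _) (add_id _) (fun _ => erefl) (fun _ => erefl).

Section SqgComp.
Variables (M M' M'' : sqgroup) (f : sqg_hom M' M'') (g : sqg_hom M M').

Lemma sqg_comp_h x :
  sqg_h (add_comp (beta_e f) (beta_e g) x)
  = add_comp (beta_ee f) (beta_ee g) (sqg_h x).
Proof. by rewrite /= !sqg_hom_h. Qed.

Lemma sqg_comp_p m :
  sqg_p (add_comp (beta_ee f) (beta_ee g) m)
  = add_comp (beta_e f) (beta_e g) (sqg_p m).
Proof. by rewrite /= !sqg_hom_p. Qed.

Definition sqg_comp : sqg_hom M M'' := SQGHom sqg_comp_h sqg_comp_p.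
End SqgComp.

Lemma sqg_hom_ext M M' (f g : sqg_hom M M') :
  beta_e f =1 beta_e g -> beta_ee f =1 beta_ee g -> f = g.
Proof.
case: f => b c p r; case: g => b' c' p' r' /= /additive_ext bE /additive_ext cE.
case: b' / bE p' r' => p' r'; case: c' / cE p' r' => p' r'.
by rewrite (Prop_irrelevance p p') (Prop_irrelevance r r').
Qed.

Lemma sqf_hom_ext q q' (f g : sqf_hom q q') :
  sqf_alpha f =1 sqf_alpha g ->
  beta_e (sqf_beta f) =1 beta_e (sqf_beta g) ->
  beta_ee (sqf_beta f) =1 beta_ee (sqf_beta g) -> f = g.
Proof.
case: f => a b p r; case: g => a' b' p' r' /= /additive_ext aE eE eeE.
have bE := sqg_hom_ext eE eeE.
case: a' / aE p' r' => p' r'; case: b' / bE {eE eeE} p' r' => p' r'.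
by rewrite (Prop_irrelevance p p') (Prop_irrelevance r r').
Qed.

Definition sqf_id (q : sqform) : sqf_hom q q :=
  @SQFHom q q (add_id _) (sqg_id _) (fun _ _ => erefl) (fun _ => erefl).

Section SqfComp.
Variables (q q' q'' : sqform) (f : sqf_hom q' q'') (g : sqf_hom q q').
Let alpha := add_comp (sqf_alpha f) (sqf_alpha g).
Let beta := sqg_comp (sqf_beta f) (sqf_beta g).

Lemma sqf_comp_lambda a1 a2 :
  sqf_lambda q'' (alpha a1) (alpha a2) = beta_ee beta (sqf_lambda q a1 a2).
Proof. by rewrite /= !sqf_hom_lambda. Qed.

Lemma sqf_comp_mu a : sqf_mu q'' (alpha a) = beta_e beta (sqf_mu q a).
Proof. by rewrite /= !sqf_hom_mu. Qed.

Definition sqf_comp : sqf_hom q q'' := SQFHom sqf_comp_lambda sqf_comp_mu.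
End SqfComp.

Definition SQF : category.
Proof.
refine (@Category sqform sqf_hom sqf_id sqf_comp _ _ _);
  by move=> *; apply: sqf_hom_ext.
Defined.

Definition sqf_form (q : sqform) : sym_form :=
  SymForm (sqf_biadd q) (@sqf_sym q).

Definition forget_hom (q q' : sqform) (f : sqf_hom q q') :
    sf_hom (sqf_form q) (sqf_form q') :=
  @SFHom (sqf_form q) (sqf_form q')
    (sqf_alpha f) (beta_ee (sqf_beta f)) (sqf_hom_lambda f).

Definition forget : functor SQF SF.
Proof.
refine (@Functor SQF SF sqf_form forget_hom _ _);
  by move=> *; apply: sf_hom_ext.
Defined.

(* The condition [M_ee = M] is built in: the values of [h] and the source of
   [p] are the target of [l] itself, so no equality of types is needed. *)
Record refinement (l : sym_form) := Refinement {
  ref_e : zmodType;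
  ref_h : {additive ref_e -> sf_val l};
  ref_p : {additive sf_val l -> ref_e};
  ref_hp : forall m, ref_h (ref_p m) = m *+ 2;
  ref_ph : forall x, ref_p (ref_h x) = x *+ 2;
  ref_mu : sf_dom l -> ref_e;
  ref_muD : forall a a',
    ref_mu (a + a') = ref_mu a + ref_mu a' + ref_p (l a a');
  ref_hmu : forall a, ref_h (ref_mu a) = l a a
}.

Definition ref_grp l (Q : refinement l) : sqgroup :=
  SQGroup (@ref_hp l Q) (@ref_ph l Q).

Definition ref_sqform l (Q : refinement l) : sqform :=
  @SQForm (sf_dom l) (ref_grp Q) l (@ref_mu l Q)
    (sf_biadd l) (@ref_muD l Q) (@ref_hmu l Q).

Lemma forget_ref l (Q : refinement l) : forget (ref_sqform Q) = l.
Proof.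
rewrite /= /sqf_form /=; move: (@sqf_sym _).
by case: l Q => A M f b s Q s'; rewrite (Prop_irrelevance s' s).
Qed.

(* [forget (ref_sqform Q)] is only propositionally equal to [l] (the symmetry
   proofs differ), so lying over the identity is stated on the underlying maps. *)
Definition over_id l (Q Q' : refinement l)
    (f : @hom SQF (ref_sqform Q) (ref_sqform Q')) : Prop :=
  (forall a, sqf_alpha f a = a) /\ (forall m, beta_ee (sqf_beta f) m = m).

(* [Q] is initial among the refinements of [l]. *)
Definition universal l (Q : refinement l) : Prop :=
  forall Q' : refinement l,
    exists! f : @hom SQF (ref_sqform Q) (ref_sqform Q'), over_id f.

Section QuotientByRelations.
Variables (V : zmodType) (I : Type) (r : I -> V).

(* The subgroup generated by the relators [r i], as the intersection of all
   subgroups containing them; membership is made boolean by [asbool]. *)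
Definition rel_span : pred V := fun x =>
  `[< forall S : {pred V}, zmod_closed S -> (forall i, r i \in S) -> x \in S >].

Lemma rel_spanP : zmod_closed rel_span.
Proof.
split=> [|x y /asboolP xP /asboolP yP]; apply/asboolP => S SP rS.
  exact: SP.1.
by apply: SP.2; [apply: xP|apply: yP].
Qed.

Definition rel_subgroup : zmodClosed V :=
  HB.pack rel_span (GRing.isZmodClosed.Build V rel_span rel_spanP).

Definition rel_quot : zmodType := Quotient.quot rel_subgroup.

Definition rel_cls : {additive V -> rel_quot} := \pi_(Quotient.quot rel_subgroup)%qT.

Lemma rel_clsE x y : (rel_cls x == rel_cls y) = rel_span (x - y).
Proof. by rewrite -Quotient.idealrBE. Qed.

Lemma rel_cls_rel i : rel_cls (r i) = 0.
Proof.
apply/eqP; rewrite -(raddf0 rel_cls) rel_clsE subr0.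
by apply/asboolP.
Qed.

Lemma rel_cls_surj (x : rel_quot) : exists v, rel_cls v = x.
Proof. by exists (repr x); apply: reprK. Qed.

Section Lift.
Variables (W : zmodType) (f : {additive V -> W}).
Hypothesis fr : forall i, f (r i) = 0.

Lemma rel_span_ker x : rel_span x -> f x = 0.
Proof.
move=> /asboolP xS; apply/eqP; rewrite -[_ == 0]/(x \in [pred y | f y == 0]).
apply: xS => [|i]; last by rewrite inE fr.
split=> [|y z]; rewrite !inE ?raddf0 // => /eqP y0 /eqP z0.
by rewrite raddfB y0 z0 subr0.
Qed.

Definition rel_lift_fun (x : rel_quot) : W := f (repr x).

Lemma rel_lift_funE v : rel_lift_fun (rel_cls v) = f v.
Proof.
apply/eqP; rewrite -subr_eq0 -raddfB; apply/eqP/rel_span_ker.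
by rewrite -rel_clsE /rel_cls /= reprK.
Qed.

Lemma rel_lift_additive : zmod_morphism rel_lift_fun.
Proof.
move=> x y; case: (rel_cls_surj x) (rel_cls_surj y) => v <- [w <-].
by rewrite -raddfB !rel_lift_funE raddfB.
Qed.

Definition rel_lift : {additive rel_quot -> W} :=
  HB.pack rel_lift_fun (GRing.isZmodMorphism.Build _ _ _ rel_lift_additive).

Lemma rel_liftE v : rel_lift (rel_cls v) = f v.
Proof. exact: rel_lift_funE. Qed.
End Lift.
End QuotientByRelations.

Definition twprod (l : sym_form) : Type := (sf_val l * sf_dom l)%type.

HB.instance Definition _ (l : sym_form) :=
  Choice.copy (twprod l) (sf_val l * sf_dom l)%type.

Section CanonicalRefinement.
Variable l : sym_form.

Definition tw_add (x y : twprod l) : twprod l :=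
  (x.1 + y.1 - l x.2 y.2, x.2 + y.2).
Definition tw_zero : twprod l := (0, 0).
Definition tw_opp (x : twprod l) : twprod l := (- x.1 - l x.2 x.2, - x.2).

Lemma tw_addA : associative tw_add.
Proof.
move=> [m a] [n b] [k c]; congr (_, _); rewrite /= ?addrA //.
rewrite (biaddDl (sf_biadd l)) (biaddDr (sf_biadd l)) !opprD !addrA.
by rewrite [RHS](ACl (1*2*4*6*3*5)).
Qed.

Lemma tw_addC : commutative tw_add.
Proof.
by move=> [m a] [n b]; rewrite /tw_add /= [m + n]addrC [a + b]addrC sf_sym.
Qed.

Lemma tw_add0 : left_id tw_zero tw_add.
Proof.
by move=> [m a]; rewrite /tw_add /= (biadd0l (sf_biadd l)) subr0 !add0r.
Qed.

Lemma tw_addN : left_inverse tw_zero tw_opp tw_add.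
Proof.
move=> [m a]; rewrite /tw_add /= (biaddNl (sf_biadd l)) opprK addNr.
by rewrite addrAC subrK addNr.
Qed.

HB.instance Definition _ :=
  GRing.isZmodule.Build (twprod l) tw_addA tw_addC tw_add0 tw_addN.

(* The operations of [twprod l] are the twisted ones, but [*+] and [-] below act
   on the components, not in [twprod l]. *)
Definition can_rel (a : sf_dom l) : twprod l := (- (l a a *+ 2), - (a *+ 2)).

Definition can_e : zmodType := rel_quot can_rel.

Definition can_cls (m : sf_val l) (a : sf_dom l) : can_e :=
  rel_cls can_rel ((m, a) : twprod l).

Lemma can_clsD m a m' a' :
  can_cls m a + can_cls m' a' = can_cls (m + m' - l a a') (a + a').
Proof. by rewrite /can_cls -raddfD. Qed.

Lemma can_clsP (x : can_e) : exists m a, x = can_cls m a.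
Proof. by case: (rel_cls_surj x) => -[m a] <-; exists m, a. Qed.

Lemma can_cls_rel a : can_cls (- (l a a *+ 2)) (- (a *+ 2)) = 0.
Proof. exact: rel_cls_rel. Qed.

Definition can_p_fun (m : sf_val l) : can_e := can_cls m 0.

Lemma can_p_additive : zmod_morphism can_p_fun.
Proof.
move=> m n; apply/eqP; rewrite eq_sym subr_eq; apply/eqP.
by rewrite can_clsD (biadd0l (sf_biadd l)) subr0 addr0 subrK.
Qed.

Definition can_p : {additive sf_val l -> can_e} :=
  HB.pack can_p_fun (GRing.isZmodMorphism.Build _ _ _ can_p_additive).

Definition can_h_pre (x : twprod l) : sf_val l := x.1 *+ 2 + l x.2 x.2.

Lemma can_h_pre_additive : nmod_morphism can_h_pre.
Proof.
split=> [|[m a] [n b]]; rewrite /can_h_pre /=.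
  by rewrite mul0rn (biadd0l (sf_biadd l)) addr0.
rewrite (biaddDl (sf_biadd l)) !(biaddDr (sf_biadd l)) (sf_sym b a).
rewrite mulrnBl mulrnDl.
have -> : l a a + l a b + (l a b + l b b) = l a b *+ 2 + (l a a + l b b).
  by rewrite mulr2n (AC (2*2) ((2*3)*(1*4))).
by rewrite addrA subrK addrACA.
Qed.

Definition can_h_tw : {additive twprod l -> sf_val l} :=
  HB.pack can_h_pre (GRing.isNmodMorphism.Build _ _ _ can_h_pre_additive).

Lemma can_h_rel a : can_h_tw (can_rel a) = 0.
Proof.
rewrite /= /can_h_pre /= (biaddNl (sf_biadd l)) (biaddNr (sf_biadd l)) opprK.
rewrite !mulr2n (biaddDl (sf_biadd l)) !(biaddDr (sf_biadd l)) -opprD.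
by rewrite addNr.
Qed.

Definition can_h : {additive can_e -> sf_val l} := rel_lift can_h_rel.

Lemma can_hE m a : can_h (can_cls m a) = m *+ 2 + l a a.
Proof. exact: rel_liftE. Qed.

Definition can_mu (a : sf_dom l) : can_e := can_cls 0 a.

Lemma can_hp m : can_h (can_p m) = m *+ 2.
Proof. by rewrite can_hE (biadd0l (sf_biadd l)) addr0. Qed.

Lemma can_ph x : can_p (can_h x) = x *+ 2.
Proof.
have [m [a ->]] := can_clsP x; rewrite can_hE.
rewrite [RHS]mulr2n can_clsD -[RHS]addr0 -(can_cls_rel a) can_clsD.
rewrite -mulr2n subrr (biaddNr (sf_biadd l)) opprK /= /can_p_fun.
congr can_cls; rewrite !mulr2n (biaddDl (sf_biadd l)) !(biaddDr (sf_biadd l)).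
by rewrite addrA subrK addrA subrK.
Qed.

Lemma can_muD a a' : can_mu (a + a') = can_mu a + can_mu a' + can_p (l a a').
Proof.
by rewrite !can_clsD (biadd0r (sf_biadd l)) subr0 !addr0 add0r addNr.
Qed.

Lemma can_hmu a : can_h (can_mu a) = l a a.
Proof. by rewrite can_hE mul0rn add0r. Qed.

Definition can_refinement : refinement l :=
  @Refinement l can_e can_h can_p can_hp can_ph can_mu can_muD can_hmu.

Definition can_sqform : SQF := ref_sqform can_refinement.
End CanonicalRefinement.

(* Main.v *)
Require Import Defs.
From HB Require Import structures.
From mathcomp Require Import all_boot all_algebra.

Set Implicit Arguments.
Unset Strict Implicit.
Unset Printing Implicit Defensive.

Import GRing.Theory.
Local Open Scope ring_scope.

(** The form-theoretic data [(alpha, beta_ee)] of a morphism out of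
    [can_sqform l] determines the remaining component [beta_e], and any such
    data extends.  Indeed [[m, a] = p [m] + mu [a]] in [can_e l], so a morphism
    into [q] must send [[m, a]] to [p (beta_ee m) + mu (alpha a)]: this is
    uniqueness ([can_hom_ext]).  Conversely this formula is additive for the
    twisted law of [twprod l], because the twist [- l a a'] cancels the
    deviation [p (lambda a a')] of [mu] from additivity, and it vanishes on the
    relators, because [mu (- (a *+ 2))] and [p (lambda a a *+ 2)] are both
    [mu a *+ 4]: this is existence ([can_ext]).

    Hence restriction to the form-theoretic data is a bijection from morphisms
    [can_sqform l -> q] to morphisms [l -> forget q], visibly natural.  Applied
    to morphisms over the identity of [l] it says that [can_refinement l] is
    initial; applied to all morphisms it is the adjunction. *)

Lemma sqf_mu0 (q : sqform) : sqf_mu q 0 = 0.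
Proof.
have := sqf_muD (s := q) 0 0.
rewrite (biadd0l (sqf_biadd q)) raddf0 !addr0 => mu0.
by apply: (addIr (sqf_mu q 0)); rewrite add0r -mu0.
Qed.

Lemma sqf_p_diag (q : sqform) a : sqg_p (sqf_lambda q a a) = sqf_mu q a *+ 2.
Proof. by rewrite -sqf_hmu sqg_ph. Qed.

(** [mu a + mu (- a) = p (lambda a a) = 2 mu a]. *)
Lemma sqf_muN (q : sqform) a : sqf_mu q (- a) = sqf_mu q a.
Proof.
have := sqf_muD (s := q) a (- a).
rewrite subrr sqf_mu0 (biaddNr (sqf_biadd q)) raddfN /= sqf_p_diag mulr2n.
rewrite opprD addrACA subrr add0r => /esym/eqP.
by rewrite subr_eq0 => /eqP.
Qed.

Lemma sqf_mu2 (q : sqform) a : sqf_mu q (a *+ 2) = sqf_mu q a *+ 4.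
Proof. by rewrite mulr2n sqf_muD sqf_p_diag -[_ + sqf_mu q a]mulr2n -mulrnDr. Qed.

Lemma can_cls_pmu (l : sym_form) (m : sf_val l) (a : sf_dom l) :
  can_cls m a = can_p l m + can_mu a.
Proof.
by rewrite /= /can_p_fun can_clsD (biadd0l (sf_biadd l)) subr0 addr0 add0r.
Qed.

Section Extension.
Variables (l : sym_form) (q : sqform) (g : sf_hom l (sqf_form q)).

Definition can_ext_pre (x : twprod l) : sqg_e (sqf_grp q) :=
  sqg_p (sf_beta g x.1) + sqf_mu q (sf_alpha g x.2).

Lemma can_ext_pre_additive : nmod_morphism can_ext_pre.
Proof.
split=> [|[m a] [n b]]; rewrite /can_ext_pre /=.
  by rewrite !raddf0 sqf_mu0 addr0.
rewrite (raddfD (sf_alpha g)) sqf_muD.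
rewrite -[sqf_lambda _ _ _]/(sqf_form q _ _) sf_homP !raddfB !raddfD /=.
by rewrite [sqf_mu _ _ + _ + _]addrC addrA subrK addrACA.
Qed.

Definition can_ext_tw : {additive twprod l -> sqg_e (sqf_grp q)} :=
  HB.pack can_ext_pre (GRing.isNmodMorphism.Build _ _ _ can_ext_pre_additive).

Lemma can_ext_rel a : can_ext_tw (can_rel a) = 0.
Proof.
rewrite /= /can_ext_pre /= (raddfN (sf_alpha g)) (raddfMn (sf_alpha g)).
rewrite sqf_muN sqf_mu2 !raddfN !raddfMn /=.
by rewrite -sf_homP /= sqf_p_diag mulNrn -mulrnA addNr.
Qed.

Definition can_ext_e : {additive can_e l -> sqg_e (sqf_grp q)} :=
  rel_lift can_ext_rel.

Lemma can_ext_eE m a :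
  can_ext_e (can_cls m a) = sqg_p (sf_beta g m) + sqf_mu q (sf_alpha g a).
Proof. exact: rel_liftE. Qed.

Lemma can_ext_h x : sqg_h (can_ext_e x) = sf_beta g (can_h l x).
Proof.
have [m [a ->]] := can_clsP x.
rewrite can_ext_eE can_hE (raddfD sqg_h).
rewrite (raddfD (sf_beta g)) (raddfMn (sf_beta g)).
by rewrite sqg_hp sqf_hmu -sf_homP.
Qed.

Lemma can_ext_p m : sqg_p (sf_beta g m) = can_ext_e (can_p l m).
Proof. by rewrite can_ext_eE raddf0 sqf_mu0 addr0. Qed.

Lemma can_ext_mu a : sqf_mu q (sf_alpha g a) = can_ext_e (can_mu a).
Proof. by rewrite can_ext_eE !raddf0 add0r. Qed.

Definition can_ext_grp : sqg_hom (ref_grp (can_refinement l)) (sqf_grp q) :=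
  @SQGHom (ref_grp (can_refinement l)) (sqf_grp q)
    can_ext_e (sf_beta g) can_ext_h can_ext_p.

Definition can_ext : sqf_hom (can_sqform l) q :=
  @SQFHom (can_sqform l) q (sf_alpha g) can_ext_grp (sf_homP g) can_ext_mu.

End Extension.

(** The group [can_e l] is generated by the values of [p] and [mu], on which [beta_e] is
    prescribed by [beta_ee] and [alpha]. *)
Lemma can_hom_ext (l : sym_form) (q : sqform) (u v : sqf_hom (can_sqform l) q) :
  sqf_alpha u =1 sqf_alpha v ->
  beta_ee (sqf_beta u) =1 beta_ee (sqf_beta v) -> u = v.
Proof.
move=> aE bE; apply: sqf_hom_ext => // x.
have [m [a ->]] := can_clsP x; rewrite can_cls_pmu.
rewrite (raddfD (beta_e (sqf_beta u))) (raddfD (beta_e (sqf_beta v))).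
rewrite -[can_p l m]/(sqg_p (s := sqf_grp (can_sqform l)) m) -!sqg_hom_p bE.
by rewrite -[can_mu a]/(sqf_mu (can_sqform l) a) -!sqf_hom_mu aE.
Qed.

(** Precomposition with the unit [l -> forget (can_sqform l)] of the adjunction,
    whose underlying maps are identities. *)
Definition can_restrict (l : sym_form) (q : sqform)
    (u : sqf_hom (can_sqform l) q) : sf_hom l (sqf_form q) :=
  @SFHom l (sqf_form q) (sqf_alpha u) (beta_ee (sqf_beta u)) (sqf_hom_lambda u).

Lemma can_restrict_bij l q : bijective (@can_restrict l q).
Proof.
exists (@can_ext l q) => [u|g]; first exact: can_hom_ext.
exact: sf_hom_ext.
Qed.

(** The morphism being extended is the composite of [f] with the unit at [l']. *)
Definition can_map (l l' : sym_form) (f : sf_hom l l') :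
    sqf_hom (can_sqform l) (can_sqform l') :=
  can_ext (@SFHom l (sqf_form (can_sqform l'))
             (sf_alpha f) (sf_beta f) (sf_homP f)).

Definition can_functor : functor SF SQF.
Proof.
refine (@Functor SF SQF can_sqform can_map _ _);
  by move=> *; apply: can_hom_ext.
Defined.

Lemma can_refinement_universal l : universal (can_refinement l).
Proof.
move=> Q'.
pose g := @SFHom l (sqf_form (ref_sqform Q')) (add_id _) (add_id _)
            (fun _ _ => erefl).
exists (can_ext g); split=> [//|v [va vb]].
by apply: can_hom_ext => x; rewrite ?va ?vb.
Qed.

Lemma can_functor_adjoint : is_left_adjoint can_functor forget.
Proof.
constructor; apply: (@Adjunction SF SQF can_functor forget can_restrict).
  exact: can_restrict_bij.
by move=> *; apply: sf_hom_ext.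
Qed.

Theorem theorem26 :
  (forall l : sym_form, exists Q : refinement l, universal Q) /\
  (exists L : functor SF SQF,
     (forall l : SF, L l = can_sqform l) /\ is_left_adjoint L forget).
Proof.
split=> [l|]; first by exists (can_refinement l); apply: can_refinement_universal.
by exists can_functor; split=> //; apply: can_functor_adjoint.
Qed.
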